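(* Let $\Omega\subset\mathbb{R}^N$ be a convex domain, let $\alpha\in(0,1]$ and let $u$ be a bounded $\alpha$-convex function in $\Omega$. Then, given $z_0\in\Omega$, there exists an $\alpha$-hyperplane $\pi_\alpha$ that touches $u$ from below at $z_0$, that is, $\pi_\alpha(z_0)=u(z_0)$ and $\pi_\alpha(z)\le u(z)$ for every $z\in\Omega$ at which $\pi_\alpha$ is defined.
   Context: Let $L_\alpha(v)(t)=\alpha v''(t)+(1-\alpha)|v'(t)|^2$. A function $u$ is $\alpha$-convex ($\alpha\in(0,1]$) if for any two points $x,y$ of its (convex) domain of definition one has $u(tx+(1-t)y)\le v(t)$ for all $t\in(0,1)$, where $v$ is the (unique classical) solution of $L_\alpha(v)=0$ in $(0,1)$ with $v(0)=u(y)$, $v(1)=u(x)$. An $\alpha$-hyperplane passing through $z_0$ with direction $\nu$ ($|\nu|=1$) is a function of the form $\pi_\alpha(z)=v(\langle z-z_0,\nu\rangle)$, where $v$ is a solution of $L_\alpha(v)=0$ on an interval $I=(-\delta,+\infty)$, $0<\delta\le+\infty$, which is its maximal interval of existence; $\pi_\alpha$ is defined on $\{z:\langle z-z_0,\nu\rangle>-\delta\}$. *)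

(* Defs.v *)
From HB Require Import structures.
From mathcomp Require Import all_boot all_order all_algebra.
From mathcomp Require Import all_classical all_reals all_analysis.

Set Implicit Arguments.
Unset Strict Implicit.
Unset Printing Implicit Defensive.

Import Order.TTheory GRing.Theory Num.Theory.
Import numFieldNormedType.Exports.

Local Open Scope classical_set_scope.
Local Open Scope ring_scope.

Section Euclidean.
Variables (R : realType) (N : nat).
Implicit Types x y : 'rV[R]_N.

Definition dot x y : R := \sum_(i < N) x ord0 i * y ord0 i.

(* The library norm on row vectors is the sup norm. *)
Definition enorm x : R := Num.sqrt (dot x x).

End Euclidean.

Section AlphaConvex.
Variables (R : realType) (alpha : R).

Definition L_op (v : R -> R) (t : R) : R :=
  alpha * derive1n 2 v t + (1 - alpha) * `|derive1 v t| ^+ 2.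

(* Only used for open I, so that the values of v outside I are irrelevant. *)
Definition classical_solution (I : set R) (v : R -> R) : Prop :=
  forall t, I t ->
    [/\ derivable v t 1, derivable (derive1 v) t 1, {for t, continuous (derive1n 2 v)}
      & L_op v t = 0].

(* v is the classical solution on (0, 1), continuous up to the endpoints, of
   the Dirichlet problem with v(0) = a and v(1) = b. *)
Definition dirichlet_solution (a b : R) (v : R -> R) : Prop :=
  [/\ classical_solution `]0, 1[ v, {within `[0, 1], continuous v},
      v 0 = a & v 1 = b].

(* The values of u outside Omega play no role when Omega is convex.
   The Dirichlet solution exists and is unique on [0, 1], so quantifying over
   all v amounts to speaking of the solution. *)
Definition alpha_convex (N : nat) (Omega : set 'rV[R]_N) (u : 'rV[R]_N -> R)
    : Prop :=
  forall x y, Omega x -> Omega y ->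
  forall v, dirichlet_solution (u y) (u x) v ->
  forall t, 0 < t < 1 -> u (t *: x + (1 - t) *: y) <= v t.

Definition maximal_solution (I : set R) (v : R -> R) : Prop :=
  classical_solution I v /\
  forall (J : set R) (w : R -> R), open J -> is_interval J -> I `<=` J ->
    classical_solution J w -> {in I, v =1 w} -> J `<=` I.

(* The partial function with domain D and values p on D (p is arbitrary
   elsewhere) is an alpha-hyperplane through z0 with direction nu. *)
Definition alpha_hyperplane (N : nat) (z0 nu : 'rV[R]_N)
    (D : set 'rV[R]_N) (p : 'rV[R]_N -> R) : Prop :=
  enorm nu = 1 /\
  exists (delta : \bar R) (v : R -> R),
    [/\ (0 < delta)%E,
        maximal_solution [set t | (- delta < t%:E)%E] v,
        D = [set z | (- delta < (dot (z - z0) nu)%:E)%E]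
      & forall z, D z -> p z = v (dot (z - z0) nu)].

End AlphaConvex.

(* Main.v *)
(** The substitution [y = exp (k v)] with [k = (1 - alpha) / alpha] (and [y = v]
    when [alpha = 1]) turns [alpha v'' + (1 - alpha) v'^2 = 0] into [y'' = 0].
    Hence the image of an alpha-convex function is an ordinary convex function,
    which has a supporting hyperplane at [z0]; undoing the substitution gives the
    alpha-hyperplane, defined where the affine function is in the range of the
    substitution.  The supporting hyperplane is a linear minorant of the
    one-sided directional derivative, a sublinear function that is made linear
    along each coordinate axis in turn. *)
Require Import Defs.
From HB Require Import structures.
From mathcomp Require Import all_boot all_order all_algebra.
From mathcomp Require Import all_classical all_reals all_analysis.
From mathcomp Require Import ring lra.

Set Implicit Arguments.
Unset Strict Implicit.
Unset Printing Implicit Defensive.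

Import Order.TTheory GRing.Theory Num.Theory.
Import numFieldNormedType.Exports.
Local Open Scope classical_set_scope.
Local Open Scope ring_scope.

(** * Sublinear functions and their linear minorants *)

Definition sublinear (R : realType) (V : lmodType R) (p : V -> R) : Prop :=
  (forall x y, p (x + y) <= p x + p y) /\
  (forall (c : R) x, 0 <= c -> p (c *: x) = c * p x).

(** Infima yield the scaling law only as an inequality; applying it to [c^-1] and [c *: x] gives the
    reverse one. *)
Lemma sublinear_of_le (R : realType) (V : lmodType R) (p : V -> R) :
  p 0 = 0 -> (forall x y, p (x + y) <= p x + p y) ->
  (forall (c : R) x, 0 < c -> p (c *: x) <= c * p x) -> sublinear p.
Proof.
move=> p0 pD pZ; split=> // c x; rewrite le_eqVlt => /predU1P[<-|c0].
  by rewrite scale0r mul0r p0.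
apply/eqP; rewrite eq_le pZ //=.
have := pZ c^-1 (c *: x); rewrite invr_gt0 => /(_ c0).
by rewrite scalerA mulVf ?gt_eqF // scale1r ler_pdivlMl.
Qed.

Lemma sublinearD0 (R : realType) (V : lmodType R) (p : V -> R) x :
  sublinear p -> 0 <= p x + p (- x).
Proof.
move=> [pD pZ]; rewrite (le_trans _ (pD _ _)) // subrr.
by rewrite -(scale0r (0 : V)) pZ // mul0r.
Qed.

(* The greatest sublinear minorant of [p] that is linear along [e] and agrees
   with [p] at [e]. *)
Lemma sublinear_linear_along (R : realType) (V : lmodType R) (p : V -> R) e :
  sublinear p -> exists q, [/\ sublinear q, forall x, q x <= p x
                             & q e + q (- e) <= 0].
Proof.
move=> ps; have [pD pZ] := ps.
pose E x := [set p (x + t *: e) - t * p e | t in [set t : R | 0 <= t]].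
pose q x := inf (E x).
have p0 : p 0 = 0 by rewrite -(scale0r (0 : V)) pZ // mul0r.
(* Subadditivity at [x + t *: e] and [- x] bounds [E x] below, so [q x] is a genuine infimum. *)
have lbE x : lbound (E x) (- p (- x)).
  move=> _ [t t0 <-]; have := pD (x + t *: e) (- x).
  by rewrite addrAC subrr add0r pZ //; lra.
have hlb x : has_lbound (E x) by exists (- p (- x)).
have q_le x t : 0 <= t -> q x <= p (x + t *: e) - t * p e.
  by move=> t0; apply: ge_inf => //; exists t.
have le_q x c : (forall t, 0 <= t -> c <= p (x + t *: e) - t * p e) -> c <= q x.
  move=> h; apply: lb_le_inf; first by exists (p (x + 0 *: e) - 0 * p e), 0 => /=.
  by move=> _ [t t0 <-]; exact: h.
have q_lep x : q x <= p x.
  by have := q_le x 0 (lexx 0); rewrite scale0r mul0r addr0 subr0.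
exists q; split => //.
- apply: sublinear_of_le.
  + apply/eqP; rewrite eq_le -{1}p0 q_lep /=; apply/le_q => t t0.
    by rewrite add0r pZ // subrr.
  + move=> x y; rewrite -lerBlDl; apply/le_q => t t0.
    rewrite lerBlDl -lerBlDr; apply/le_q => s s0.
    have := q_le (x + y) (s + t) (addr_ge0 s0 t0).
    have := pD (x + s *: e) (y + t *: e).
    rewrite scalerDl addrACA; lra.
  + move=> c x c0; rewrite -ler_pdivrMl //; apply/le_q => t t0.
    rewrite ler_pdivrMl //; have ct : 0 <= c * t by rewrite mulr_ge0 // ltW.
    have := q_le (c *: x) (c * t) ct.
    by rewrite -scalerA -scalerDr (pZ c _ (ltW c0)) mulrBr mulrA.
(* At [- e], the choice [t = 1] gives [q (- e) <= p 0 - p e = - p e]. *)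
- have := q_le (- e) 1 ler01; rewrite scale1r addNr p0.
  have := q_lep e; lra.
Qed.

(** Linearity along a vector already treated survives later steps: the bound [q e + q (- e) <= 0]
    passes to every smaller function. *)
Lemma sublinear_linear_along_seq (R : realType) (V : lmodType R) (s : seq V)
    (p : V -> R) : sublinear p ->
  exists q, [/\ sublinear q, forall x, q x <= p x
              & {in s, forall e, q e + q (- e) <= 0}].
Proof.
elim: s p => [|e s IH] p ps; first by exists p; split.
have [q [qs qp qe]] := sublinear_linear_along e ps.
have [r [rs rq re]] := IH q qs.
exists r; split => // [x|x]; first exact: le_trans (rq x) (qp x).
rewrite inE => /predU1P[->|xs]; last exact: re.
by rewrite (le_trans _ qe) // lerD.
Qed.

Lemma sublinear_dot_minorant (R : realType) (N : nat) (p : 'rV[R]_N -> R) :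
  sublinear p -> exists w, forall h, dot h w <= p h.
Proof.
move=> ps; pose e i : 'rV[R]_N := delta_mx 0 i.
have [q [qs qp qe]] := sublinear_linear_along_seq [seq e i | i <- enum 'I_N] ps.
have [qD qZ] := qs.
have qN i : q (- e i) <= - q (e i).
  have: e i \in [seq e i | i <- enum 'I_N] by apply: map_f; rewrite mem_enum.
  by move=> /qe; lra.
have q_le c i : q (c *: e i) <= c * q (e i).
  have [c0|c0] := leP 0 c; first by rewrite qZ.
  have c0' : 0 <= - c by lra.
  have -> : c *: e i = - c *: - e i by rewrite scaleNr scalerN opprK.
  by rewrite qZ //; have := ler_wpM2l c0' (qN i); lra.
have q0 : q 0 = 0 by rewrite -(scale0r (0 : 'rV[R]_N)) qZ // mul0r.
exists (\row_i q (e i)) => h; apply: le_trans (qp h).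
(* Subadditivity bounds a sum only from above, so [q (- h)] is expanded in coordinates;
   [0 <= q h + q (- h)] then turns this into a lower bound for [q h]. *)
suff : q (- h) <= - dot h (\row_i q (e i)) by have := sublinearD0 h qs; lra.
rewrite {1}[h]row_sum_delta -sumrN /dot -sumrN.
elim/big_rec2 : _ => [|i y1 y2 _ IH]; first by rewrite q0.
by rewrite (le_trans (qD _ _)) // lerD // mxE -scaleNr -mulNr q_le.
Qed.

(** * Supporting hyperplanes of convex functions *)

Lemma convex_support (R : realType) (N : nat) (O : set 'rV[R]_N)
    (f : 'rV[R]_N -> R) (z0 : 'rV[R]_N) :
  O z0 -> (forall h, exists2 s, 0 < s & O (z0 + s *: h)) ->
  (forall x y t, O x -> O y -> 0 < t < 1 ->
    O (t *: x + (1 - t) *: y) /\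
    f (t *: x + (1 - t) *: y) <= t * f x + (1 - t) * f y) ->
  exists w, forall z, O z -> f z0 + dot (z - z0) w <= f z.
Proof.
move=> Oz0 Oint fconv.
(* [D h] is the one-sided derivative of [f] at [z0] in the direction [h]. *)
pose E h := [set (f (z0 + t *: h) - f z0) / t
            | t in [set t : R | 0 < t /\ O (z0 + t *: h)]].
pose D h := inf (E h).
(* The step [r] is chosen so that [z0 + r *: (x + y)] is a convex combination of the two given
   points: with [l = t / (s + t)], both [l * s] and [(1 - l) * t] equal [r]. Dividing the convexity
   inequality by [r] then restores the weights [1 / s] and [1 / t]. *)
have key x y s t : 0 < s -> 0 < t -> O (z0 + s *: x) -> O (z0 + t *: y) ->
    let r := s * t / (s + t) in
    [/\ 0 < r, O (z0 + r *: (x + y)) &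
     (f (z0 + r *: (x + y)) - f z0) / r <=
     (f (z0 + s *: x) - f z0) / s + (f (z0 + t *: y) - f z0) / t].
  move=> s0 t0 Ox Oy r; have st : 0 < s + t by rewrite addr_gt0.
  have r0 : 0 < r by rewrite divr_gt0 // mulr_gt0.
  pose l := t / (s + t).
  have l01 : 0 < l < 1.
    by rewrite divr_gt0 //= ltr_pdivrMr // mul1r ltrDr.
  have ls : l * s = r by rewrite /l /r; field; exact: lt0r_neq0.
  have lt : (1 - l) * t = r by rewrite /l /r; field; exact: lt0r_neq0.
  have e : z0 + r *: (x + y) = l *: (z0 + s *: x) + (1 - l) *: (z0 + t *: y).
    rewrite !scalerDr !scalerA ls lt addrACA -scalerDl [l + _]addrC subrK.
    by rewrite scale1r.
  have [] := fconv _ _ l Ox Oy l01; rewrite -e => Or fr; split=> //.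
  rewrite ler_pdivrMr // mulrDl.
  have -> : (f (z0 + s *: x) - f z0) / s * r = l * (f (z0 + s *: x) - f z0).
    by rewrite -ls; field; exact: lt0r_neq0.
  have -> : (f (z0 + t *: y) - f z0) / t * r = (1 - l) * (f (z0 + t *: y) - f z0).
    by rewrite -lt; field; exact: lt0r_neq0.
  lra.
(* Any admissible quotient in the direction [- h] gives a lower bound: in [key] the two directions
   cancel and the left-hand side is 0. *)
have lbE h : has_lbound (E h).
  have [s s0 Os] := Oint (- h).
  exists (- ((f (z0 + s *: - h) - f z0) / s)) => _ [t [t0 Ot] <-].
  have [_ _] := key _ _ _ _ t0 s0 Ot Os.
  by rewrite subrr scaler0 addr0 subrr mul0r; lra.
have D_le h t : 0 < t -> O (z0 + t *: h) -> D h <= (f (z0 + t *: h) - f z0) / t.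
  by move=> t0 Ot; apply: ge_inf => //; exists t.
have le_D h c : (forall t, 0 < t -> O (z0 + t *: h) ->
    c <= (f (z0 + t *: h) - f z0) / t) -> c <= D h.
  move=> H; apply: lb_le_inf.
    by have [s s0 Os] := Oint h; exists ((f (z0 + s *: h) - f z0) / s), s.
  by move=> _ [t [t0 Ot] <-]; exact: H.
have Ds : sublinear D.
  apply: sublinear_of_le.
  - apply/eqP; rewrite eq_le; apply/andP; split.
      have := @D_le 0 1 ltr01; rewrite scaler0 addr0 subrr mul0r; exact.
    by apply/le_D => t _ _; rewrite scaler0 addr0 subrr mul0r.
  - move=> x y; rewrite -lerBlDl; apply/le_D => t t0 Ot.
    rewrite lerBlDl -lerBlDr; apply/le_D => s s0 Os; rewrite lerBlDr.
    have [r0 Or] := key _ _ _ _ s0 t0 Os Ot.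
    exact/le_trans/D_le.
  - move=> c x c0; rewrite -ler_pdivrMl //; apply/le_D => t t0 Ot.
    rewrite ler_pdivrMl //; have tc : 0 < t / c by rewrite divr_gt0.
    (* A step [t] along [x] is a step [t / c] along [c *: x]. *)
    have e : (t / c) *: (c *: x) = t *: x by rewrite scalerA divfK ?gt_eqF.
    have := @D_le (c *: x) (t / c) tc; rewrite e => /(_ Ot) /le_trans; apply.
    by rewrite invf_div mulrC mulrAC mulrA.
have [w wD] := sublinear_dot_minorant Ds.
exists w => z Oz; have zz : z0 + 1 *: (z - z0) = z by rewrite scale1r addrC subrK.
have := D_le (z - z0) 1 ltr01; rewrite zz divr1 => /(_ Oz).
have := wD (z - z0); lra.
Qed.

(** * Classical solutions and the linearizing substitution *)

Lemma classical_solution_of_is_derive (R : realType) (alpha : R) (I : set R)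
    (v v1 v2 : R -> R) : open I ->
  (forall t, I t -> [/\ is_derive t 1 v (v1 t), is_derive t 1 v1 (v2 t),
     {for t, continuous v2} & alpha * v2 t + (1 - alpha) * v1 t ^+ 2 = 0]) ->
  classical_solution alpha I v.
Proof.
move=> oI H.
have nI t : I t -> nbhs t I by move=> It; apply: open_nbhs_nbhs.
have d1 t : I t -> derive1 v t = v1 t.
  by case/H => h _ _ _; rewrite derive1E derive_val.
(* As [I] is open, equality on [I] is equality near each of its points, so it can be
   differentiated. *)
have n1 t : I t -> {near t, derive1 v =1 v1}.
  by move=> It; near=> s; apply: d1; near: s; exact: nI.
have d2 t : I t -> derive1n 2 v t = v2 t.
  move=> It; have [_ h _ _] := H t It.
  rewrite /derive1n /= derive1E (near_eq_derive _ (n1 t It)); exact: derive_val.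
move=> t It; have [h1 h2 c e] := H t It; split.
- exact: ex_derive.
- apply: near_eq_derivable (@ex_derive _ _ _ _ _ _ _ h2).
  by near=> s; apply/esym/d1; near: s; exact: nI.
- rewrite /prop_for /continuous_at d2 //; apply: cvg_trans c.
  apply: near_eq_cvg; near=> s; apply/esym/d2; near: s; exact: nI.
- rewrite /L_op d2 // d1 // real_normK //; exact: num_real.
Unshelve. all: by end_near. Qed.
Definition linearize (R : realType) (alpha x : R) : R :=
  if alpha == 1 then x else expR ((1 - alpha) / alpha * x).

(** Inverts [linearize] only on [linearized_range]; for [alpha] other than 1 its values at [y <= 0]
    have no meaning. *)
Definition delinearize (R : realType) (alpha y : R) : R :=
  if alpha == 1 then y else alpha / (1 - alpha) * ln y.

Definition linearized_range (R : realType) (alpha : R) : set R :=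
  [set y | (alpha == 1) || (0 < y)].

Lemma linearize_range (R : realType) (alpha x : R) :
  linearized_range alpha (linearize alpha x).
Proof.
by rewrite /linearized_range /linearize /=; case: eqP => //= _; exact: expR_gt0.
Qed.

Lemma linearized_range_conv (R : realType) (alpha t x y : R) :
  0 <= t <= 1 -> linearized_range alpha x -> linearized_range alpha y ->
  linearized_range alpha (t * x + (1 - t) * y).
Proof.
rewrite /linearized_range /=; case: eqP => //= _ /andP[t0 t1] x0 y0.
have [->|t0'] := eqVneq t 0; first by lra.
have tx : 0 < t * x by rewrite mulr_gt0 // lt0r t0'.
have ty : 0 <= (1 - t) * y by rewrite mulr_ge0 ?subr_ge0 // ltW.
lra.
Qed.

Lemma linearizeK (R : realType) (alpha : R) :
  0 < alpha <= 1 -> cancel (linearize alpha) (delinearize alpha).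
Proof.
move=> /andP[a0 a1] x; rewrite /linearize /delinearize; case: eqP => // /eqP a.
by rewrite expRK; field; rewrite (lt0r_neq0 a0) subr_eq0 eq_sym.
Qed.

Lemma delinearizeK (R : realType) (alpha y : R) : 0 < alpha <= 1 ->
  linearized_range alpha y -> linearize alpha (delinearize alpha y) = y.
Proof.
move=> /andP[a0 a1]; rewrite /linearize /delinearize /linearized_range /=.
case: eqP => //= /eqP a y0; rewrite mulrA [X in X * _](_ : _ = 1).
  by rewrite mul1r lnK.
by field; rewrite subr_eq0 eq_sym a lt0r_neq0.
Qed.

Lemma ler_linearize (R : realType) (alpha : R) :
  0 < alpha <= 1 -> {mono linearize alpha : x y / x <= y}.
Proof.
move=> /andP[a0 a1] x y; rewrite /linearize; case: eqP => // /eqP a.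
by rewrite ler_expR ler_pM2l // divr_gt0 // subr_gt0 lt_neqAle a.
Qed.

Lemma continuous_linearize (R : realType) (alpha : R) :
  continuous (linearize alpha).
Proof.
rewrite /linearize; case: eqP => _ x; first exact: cvg_id.
by apply: continuous_comp; [exact: mulrl_continuous|exact: continuous_expR].
Qed.

Lemma delinearize_affine_solution (R : realType) (alpha A B : R) :
  0 < alpha <= 1 ->
  classical_solution alpha [set t | linearized_range alpha (A + B * t)]
    (fun t => delinearize alpha (A + B * t)).
Proof.
move=> /andP[a0 a1]; have dl (t : R) : is_derive t 1 (fun s : R => A + B * s) B.
  by apply: is_derive_eq; rewrite add0r mul1r -[RHS]mulr1.
have cl (t : R) : {for t, continuous (fun s : R => A + B * s)}.
  by apply: differentiable_continuous; apply/derivable1_diffP; exact: ex_derive.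
rewrite /linearized_range /delinearize; case: eqP => [->|/eqP a] /=.
  apply: (@classical_solution_of_is_derive _ _ _ _ (cst B) (cst 0)) => [|t _].
    have -> : [set _ | true] = [set: R] by exact/seteqP.
    exact: openT.
  split => //=; [exact: is_derive_cst | exact: cst_continuous |].
  by rewrite subrr mulr0 mul0r addr0.
have a' : 1 - alpha != 0 by rewrite subr_eq0 eq_sym.
(* These are the first two derivatives of [ln (A + B * t) / k], where [k = (1 - alpha) / alpha]. The
   equation holds because [alpha / k = (1 - alpha) / k ^ 2]. *)
apply: (@classical_solution_of_is_derive _ _ _ _
  (fun t => alpha / (1 - alpha) * (B * (A + B * t)^-1))
  (fun t => alpha / (1 - alpha) * (- B ^+ 2 * (A + B * t)^-1 ^+ 2))) => [|t /= It].
  apply: (open_comp (f := fun t : R => A + B * t)) (@open_gt _ 0).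
  by move=> t _; exact: cl.
have It0 := lt0r_neq0 It.
have dV : is_derive t 1 (fun s : R => (A + B * s)^-1) (- B * (A + B * t)^-1 ^+ 2).
  have h := @is_deriveV _ (fun s : R => A + B * s) _ _ _ It0 (dl t).
  apply: (is_derive_eq h).
  by rewrite /GRing.scale /= -exprVn; ring.
have dL : is_derive t 1 (fun s : R => ln (A + B * s)) ((A + B * t)^-1 * B).
  exact: (@is_derive1_comp _ _ (fun s : R => A + B * s) _ _ _
    (is_derive1_ln It) (dl t)).
split.
- by apply: is_derive_eq; rewrite /GRing.scale /=; ring.
- by apply: is_derive_eq; rewrite /GRing.scale /=; ring.
- have c : {for t, continuous (fun s : R => (A + B * s)^-1)}.
    by apply: differentiable_continuous; apply/derivable1_diffP; exact: ex_derive.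
  apply: cvgM; first exact: cvg_cst.
  by apply: cvgM; [exact: cvg_cst | apply: cvgM].
- by field; rewrite It0.
Qed.

(** * The Dirichlet problem and convexity after linearization *)

Lemma linearized_dirichlet (R : realType) (alpha a b : R) : 0 < alpha <= 1 ->
  let v t := delinearize alpha
    (linearize alpha a + (linearize alpha b - linearize alpha a) * t) in
  dirichlet_solution alpha a b v /\
  forall t, 0 <= t <= 1 ->
    linearize alpha (v t) = t * linearize alpha b + (1 - t) * linearize alpha a.
Proof.
move=> ha v; set A := linearize alpha a; set B := linearize alpha b - A.
(* The range is convex, so the affine interpolant stays in it on all of [[0, 1]]; including the
   endpoints gives continuity on the closed interval. *)
have rng t : 0 <= t <= 1 -> linearized_range alpha (A + B * t).
  move=> t01.
  have := linearized_range_conv t01 (linearize_range alpha b)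
    (linearize_range alpha a).
  by rewrite -/A; congr (linearized_range _ _); rewrite /B; ring.
have sol := @delinearize_affine_solution _ _ A B ha.
split; last first.
  by move=> t t01; rewrite /v delinearizeK; [rewrite -/A; ring|by []|exact: rng].
split.
- move=> t /=; rewrite in_itv /= => /andP[t0 t1].
  by apply: sol; apply: rng; rewrite !ltW.
- apply: derivable_within_continuous => t; rewrite in_itv /= => t01.
  by have [] := sol t (rng t t01).
- by rewrite /v mulr0 addr0 linearizeK.
- by rewrite /v mulr1 addrC subrK linearizeK.
Qed.

(** The explicit Dirichlet solution is fed to [alpha_convex]; [linearize] is increasing and maps
    that solution to the chord. *)
Lemma linearize_alpha_convex (R : realType) (alpha : R) (N : nat)
    (O : set 'rV[R]_N) (u : 'rV[R]_N -> R) :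
  0 < alpha <= 1 -> alpha_convex alpha O u ->
  forall x y t, O x -> O y -> 0 < t < 1 ->
  linearize alpha (u (t *: x + (1 - t) *: y)) <=
    t * linearize alpha (u x) + (1 - t) * linearize alpha (u y).
Proof.
move=> ha hu x y t Ox Oy t01.
have [dv lv] := linearized_dirichlet (u y) (u x) ha.
rewrite -lv; last by lra.
by rewrite ler_linearize //; exact: (hu _ _ Ox Oy _ dv).
Qed.

(* An extension [w] of [v] beyond [- delta] would be continuous there, so that
   [linearize alpha (w (- delta)) = 0], outside the range of [linearize alpha]. *)
Lemma maximal_delinearize_affine (R : realType) (alpha u0 B : R) :
  0 < alpha <= 1 -> 0 <= B ->
  let v t := delinearize alpha (linearize alpha u0 + B * t) in
  exists2 delta : \bar R, (0 < delta)%E &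
    maximal_solution alpha [set t | (- delta < t%:E)%E] v /\
    forall t, (- delta < t%:E)%E ->
      linearize alpha (v t) = linearize alpha u0 + B * t.
Proof.
move=> ha B0 v; set A := linearize alpha u0.
have sol := @delinearize_affine_solution _ _ A B ha.
(* For [alpha = 1] or a constant affine function, the solution is global and [delta] is infinite. *)
have [/orP aB|] := boolP ((alpha == 1) || (B == 0)).
  have rng t : linearized_range alpha (A + B * t).
    case: aB => [/eqP|/eqP] -> ; first by rewrite /linearized_range /= eqxx.
    by rewrite mul0r addr0; exact: linearize_range.
  exists +oo%E => //; split; last by move=> t _; rewrite delinearizeK.
  split=> [t _|J w _ _ _ _ _ t _ /=]; first by apply: sol; exact: rng.
  exact: ltNyr.
rewrite negb_or => /andP[a1 Bn0].
have {}B0 : 0 < B by rewrite lt0r Bn0.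
have rngE t : linearized_range alpha t = (0 < t) :> Prop.
  by rewrite /linearized_range /= (negbTE a1).
have A0 : 0 < A by have := linearize_range alpha u0; rewrite rngE.
(* The zero of [A + B * t], where the logarithm blows up. *)
pose t0 := - (A / B).
have AB t : A + B * t = B * (t - t0) by rewrite /t0; field.
have IE t : (- (A / B)%:E < t%:E)%E = (0 < A + B * t).
  by rewrite -EFinN lte_fin -/t0 AB pmulr_rgt0 // subr_gt0.
exists (A / B)%:E; first by rewrite lte_fin divr_gt0.
split; last by move=> t; rewrite IE => It; rewrite delinearizeK // rngE.
split=> [t /=|J w oJ iJ IJ solw vw t Jt /=].
  by rewrite IE -rngE => /sol.
rewrite IE AB pmulr_rgt0 // subr_gt0 ltNge; apply/negP => tt0.
have t0_lt0 : t0 < 0 by rewrite oppr_lt0 divr_gt0.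
have Jt0 : J t0.
  apply: (iJ t 0) => //; last by rewrite tt0 ltW.
  by apply: IJ => /=; rewrite IE mulr0 addr0.
have [dw _ _ _] := solw _ Jt0.
have cw : {for t0, continuous w}.
  by apply: differentiable_continuous; apply/derivable1_diffP.
have c1 : linearize alpha (w s) @[s --> t0^'+] --> linearize alpha (w t0).
  apply: cvg_at_right_filter; apply: continuous_comp cw _; exact: continuous_linearize.
have c2 : A + B * s @[s --> t0^'+] --> A + B * t0.
  apply: cvg_at_right_filter; apply: cvgD; first exact: cvg_cst.
  by apply: cvgM; [exact: cvg_cst|exact: cvg_id].
(* Only limits from the right are compared, since [w] is known to agree with [v] only to the right
   of [t0]. *)
have e : linearize alpha (w s) @[s --> t0^'+] --> A + B * t0.
  apply: cvg_trans c2; apply: near_eq_cvg; near=> s.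
  have Is : 0 < A + B * s.
    by rewrite AB pmulr_rgt0 // subr_gt0; near: s; exact: nbhs_right_gt.
  by rewrite -vw ?inE /= ?IE // delinearizeK // rngE.
have := cvg_unique _ c1 e; rewrite AB subrr mulr0 => /(_ (@Rhausdorff R)).
by have := linearize_range alpha (w t0); rewrite rngE => /[swap] ->; rewrite ltxx.
Unshelve. all: by end_near. Qed.

(** * Geometry of the domain and of the Euclidean product *)

Lemma algebraic_interior_of_open (R : realType) (N : nat) (O : set 'rV[R]_N)
    (z0 h : 'rV[R]_N) : open O -> O z0 -> exists2 s, 0 < s & O (z0 + s *: h).
Proof.
move=> oO Oz0.
have c : z0 + s *: h @[s --> (0 : R)^'+] --> z0.
  rewrite -[X in _ --> X]addr0 -(scale0r h).
  apply: cvg_at_right_filter; apply: cvgD; first exact: cvg_cst.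
  by apply: cvgZr_tmp; exact: cvg_id.
have nO : \forall s \near (0 : R)^'+, O (z0 + s *: h).
  by apply: c; exact: open_nbhs_nbhs.
near (0 : R)^'+ => s; exists s; near: s => //; exact: nbhs_right_gt.
Unshelve. all: by end_near. Qed.

Lemma convex_setP (R : realType) (V : lmodType R) (O : set V) :
  convex_set (M := V) O ->
  forall x y (t : R), O x -> O y -> 0 < t < 1 -> O (t *: x + (1 - t) *: y).
Proof.
move=> cO x y t Ox Oy /andP[t0 t1].
by have /= := cO x y (Itv01 (ltW t0) (ltW t1)); rewrite !inE; apply.
Qed.

Lemma dotZr (R : realType) (N : nat) (c : R) (x y : 'rV[R]_N) :
  dot x (c *: y) = c * dot x y.
Proof. by rewrite /dot mulr_sumr; apply: eq_bigr => i _; rewrite mxE mulrCA. Qed.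

Lemma dotZl (R : realType) (N : nat) (c : R) (x y : 'rV[R]_N) :
  dot (c *: x) y = c * dot x y.
Proof. by rewrite /dot mulr_sumr; apply: eq_bigr => i _; rewrite mxE mulrA. Qed.

Lemma dot_eq0 (R : realType) (N : nat) (x : 'rV[R]_N) : (dot x x == 0) = (x == 0).
Proof.
apply/idP/eqP => [|->]; last by rewrite /dot big1 // => i _; rewrite mxE mul0r.
rewrite /dot psumr_eq0 => [/allP h|i _]; last exact: sqr_ge0.
apply/rowP => i; apply/eqP; rewrite mxE -sqrf_eq0 expr2.
by apply: h; rewrite mem_index_enum.
Qed.

(** For [w = 0] any unit vector serves, and [0 < N] provides one. The sign of [B] makes the solution
    [v] break down, if at all, on the negative side, as the domain of an alpha-hyperplane
    demands. *)
Lemma polar_decomposition (R : realType) (N : nat) (w : 'rV[R]_N) : (0 < N)%N ->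
  exists nu B, [/\ enorm nu = 1, 0 <= B & w = B *: nu].
Proof.
move=> hN; have [->|w0] := eqVneq w 0.
  exists (delta_mx 0 (Ordinal hN)), 0; split => //; last by rewrite scale0r.
  rewrite /enorm /dot (bigD1 (Ordinal hN)) //= big1 => [|i /negbTE ni].
    by rewrite !mxE !eqxx mulr1 addr0 sqrtr1.
  by rewrite !mxE ni andbF mul0r.
have B0 : enorm w != 0.
  by rewrite sqrtr_eq0 -ltNge lt0r dot_eq0 w0 sumr_ge0 // => i _; exact: sqr_ge0.
exists ((enorm w)^-1 *: w), (enorm w); split; last by rewrite scalerA divff // scale1r.
  rewrite {1}/enorm dotZl dotZr mulrA -expr2 sqrtrM ?sqr_ge0 // sqrtr_sqr.
  by rewrite -/(enorm w) ger0_norm ?invr_ge0 ?sqrtr_ge0 // mulVf.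
exact: sqrtr_ge0.
Qed.

Theorem theorem2p21 (R : realType) (N : nat) (hN : (0 < N)%N)
    (Omega : set 'rV[R]_N) (hopen : open Omega) (hconn : connected Omega)
    (hconv : convex_set (M := 'rV[R]_N) Omega)
    (alpha : R) (halpha0 : 0 < alpha) (halpha1 : alpha <= 1)
    (u : 'rV[R]_N -> R) (hbdd : [bounded u z | z in Omega])
    (hu : alpha_convex alpha Omega u)
    (z0 : 'rV[R]_N) (hz0 : Omega z0) :
  exists (nu : 'rV[R]_N) (D : set 'rV[R]_N) (p : 'rV[R]_N -> R),
    [/\ alpha_hyperplane alpha z0 nu D p,
        p z0 = u z0
      & forall z, Omega z -> D z -> p z <= u z].
Proof.
have ha : 0 < alpha <= 1 by rewrite halpha0.
have [||w hw] := @convex_support _ _ Omega (linearize alpha \o u) z0 hz0.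
- by move=> h; exact: algebraic_interior_of_open.
- move=> x y t Ox Oy t01; split; first exact: convex_setP.
  exact: linearize_alpha_convex ha hu _ _ _ Ox Oy t01.
have [nu [B [nu1 B0 wE]]] := polar_decomposition w hN.
have [delta d0 [vmax vE]] := maximal_delinearize_affine (u z0) ha B0.
exists nu, [set z | (- delta < (dot (z - z0) nu)%:E)%E].
exists (fun z => delinearize alpha (linearize alpha (u z0) + B * dot (z - z0) nu)).
split; first by split=> //; exists delta; eexists; split; [| exact: vmax | |].
  by rewrite subrr -(scale0r (0 : 'rV[R]_N)) dotZl mul0r mulr0 addr0 linearizeK.
(* As [linearize] is increasing, the inequality may be checked after linearization, where on [D] it
   is the supporting hyperplane bound. *)
move=> z Oz Dz; rewrite -(ler_linearize ha) vE //.
by have := hw z Oz; rewrite wE dotZr.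
Qed.
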